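(* Let $\varSigma=(\mathbb{N},X,U,\mathcal{U},\phi)$ be a discrete-time control system. Let $Q$ be a controlled invariant set and let $\mathcal{C}=(\mathcal{A},\tau,\nu)$ be a clopen invariant partition of $Q$. Suppose that $K$ is a non-empty compact subset of $Q$ and $\varphi\in C(U,\mathbb{R})$ with $\varphi>0$. Then $${\rm dim}_{\mathcal{C}}^{BS}(\varphi,K,Q)=\sup\{\underline{h}_{\mu,inv}(\varphi,Q,\mathcal{C}):\ \mu\in M(Q),\ \mu(K)=1\},$$ where ${\rm dim}_{\mathcal{C}}^{BS}(\varphi,K,Q)$ is the BS invariance dimension of $\varphi$ on $K$ w.r.t. $\mathcal{C}$, $\underline{h}_{\mu,inv}(\varphi,Q,\mathcal{C})$ is the measure-theoretic lower BS invariance pressure of $\mu$ w.r.t. $\mathcal{C}$ and $\varphi$, and $M(Q)$ is the set of Borel probability measures on $Q$.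
   Context: Control system. $\mathbb{N}=\{0,1,2,\dots\}$. $X$ is a metric space, $U$ is a compact metric space, $F:X\times U\to X$ is a map such that $F_u:=F(\cdot,u):X\to X$ is continuous for each fixed $u\in U$, and $\mathcal{U}$ is a subset of the set of all sequences $\omega=(\omega_k)_{k\in\mathbb{N}}$ in $U$. For a control sequence $\omega$ (infinite, or finite of length at least $k$) put $\phi(k,x,\omega)=F_{\omega_{k-1}}\circ\cdots\circ F_{\omega_0}(x)$, $\phi(0,x,\omega)=x$. The tuple $\varSigma=(\mathbb{N},X,U,\mathcal{U},\phi)$ is called a discrete-time control system. $C(U,\mathbb{R})$ is the set of continuous real functions on $U$. Controlled invariant set. A non-empty compact set $Q\subset X$ such that for every $x\in Q$ there is $\omega_x\in\mathcal{U}$ with $\phi(n,x,\omega_x)\in Q$ for all $n\in\mathbb{N}$. Invariant partition. A triple $\mathcal{C}=(\mathcal{A},\tau,\nu)$ where $\mathcal{A}=\{A_1,\dots,A_q\}$ is a finite Borel partition of $Q$, $\tau\geq 1$ is an integer, and $\nu:\mathcal{A}\to U^\tau$ is a map such that $\phi(j,A_i,\nu(A_i))\subset Q$ for all $1\le i\le q$ and all integers $0\le j\le\tau$. It is clopen if each $A_i$ is both open and closed in the metric space $Q$. Put $S=\{1,\dots,q\}$, $\omega_i:=\nu(A_i)$, and for a finite or infinite word $s=(s_0,s_1,\dots)$ over $S$ let $\omega_s=\omega_{s_0}\omega_{s_1}\cdots$ be the concatenation (of length $n\tau$ if $s$ has length $n$). For every $x\in Q$ there is a unique $\mathcal{C}(x)=(\mathcal{C}_j(x))_{j\in\mathbb{N}}\in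 S^{\mathbb{N}}$ with $\phi(j\tau,x,\omega_{\mathcal{C}(x)})\in A_{\mathcal{C}_j(x)}$ for every $j\in\mathbb{N}$. Write $\mathcal{C}_{[0,n)}(x)=(\mathcal{C}_0(x),\dots,\mathcal{C}_{n-1}(x))$; so $\omega_{\mathcal{C}_{[0,n)}(x)}\in U^{n\tau}$. The cylindrical set of $x\in Q$ of length $n$ is $Q_n(x,\mathcal{C})=\{y\in Q:\mathcal{C}_j(y)=\mathcal{C}_j(x),\ j=0,\dots,n-1\}$. For $\omega=(\omega_0,\dots,\omega_{n-1})\in U^n$ and $f\in C(U,\mathbb{R})$ put $S_nf(\omega)=\sum_{j=0}^{n-1}f(\omega_j)$. BS invariance dimension. For $Z\subset Q$, $\varphi\in C(U,\mathbb{R})$ with $\varphi>0$, $\lambda\in\mathbb{R}$, $N\in\mathbb{N}$, $$R_{\mathcal{C}}(\varphi,Z,Q,\lambda,N)=\inf\Big\{\sum_{i\in I}e^{-\lambda S_{n_i\tau}\varphi(\omega_{\mathcal{C}_{[0,n_i)}(x_i)})}\Big\},$$ the infimum being over all finite or countable families $\{Q_{n_i}(x_i,\mathcal{C})\}_{i\in I}$ with $x_i\in Q$, $n_i\ge N$ and $\bigcup_{i\in I}Q_{n_i}(x_i,\mathcal{C})\supset Z$; $R_{\mathcal{C}}(\varphi,Z,Q,\lambda)=\lim_{N\to\infty}R_{\mathcal{C}}(\varphi,Z,Q,\lambda,N)$ (monotone limit), and $${\rm dim}_{\mathcal{C}}^{BS}(\varphi,Z,Q)=\inf\{\lambda: R_{\mathcal{C}}(\varphi,Z,Q,\lambda)=0\}=\sup\{\lambda: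 R_{\mathcal{C}}(\varphi,Z,Q,\lambda)=\infty\}.$$ Measure-theoretic lower BS invariance pressure. For $\mu\in M(Q)$, $$\underline{h}_{\mu,inv}(\varphi,Q,\mathcal{C})=\int_Q\liminf_{n\to\infty}-\frac{\log\mu(Q_n(x,\mathcal{C}))}{S_{n\tau}\varphi(\omega_{\mathcal{C}_{[0,n)}(x)})}\,d\mu(x),$$ with $-\log 0=+\infty$. *)

(* Defs.v *)
From HB Require Import structures.
From mathcomp Require Import all_boot all_order all_algebra.
From mathcomp Require Import all_classical all_reals all_analysis.

Set Implicit Arguments.
Unset Strict Implicit.
Unset Printing Implicit Defensive.

Import Order.TTheory GRing.Theory Num.Theory.
Import numFieldNormedType.Exports.

Local Open Scope classical_set_scope.
Local Open Scope ring_scope.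

Record control_system (R : realType) (X U : metricType R) := ControlSystem {
  transition : X -> U -> X;
  controls : set (nat -> U);
  input_compact : compact [set: U];
  transition_continuous : forall u, continuous (transition ^~ u) }.

(* For a finite control word [w] (meaningful when [k <= size w]); an infinite
   control sequence [w : nat -> U] enters through its prefix [mkseq w k]. *)
Definition phi (R : realType) (X U : metricType R) (Sigma : control_system X U)
    (k : nat) (x : X) (w : seq U) : X :=
  foldl (transition Sigma) x (take k w).

Record controlled_invariant_set (R : realType) (X U : metricType R)
    (Sigma : control_system X U) := ControlledInvariantSet {
  carrier : set X;
  carrier_nonempty : carrier !=set0;
  carrier_compact : compact carrier;
  carrier_invariant : forall x, carrier x ->
    exists2 w : nat -> U, controls Sigma w &
      forall n, carrier (phi Sigma n x (mkseq w n)) }.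

(* The space of points of Q, with the topology induced by X.  It is given an
   (arbitrary) distinguished point because measurable types are pointed. *)
Definition points (R : realType) (X U : metricType R)
  (Sigma : control_system X U) (Q : controlled_invariant_set Sigma) : Type :=
  set_type (carrier Q).

Coercion points : controlled_invariant_set >-> Sortclass.

Section Points.
Context {R : realType} {X U : metricType R} {Sigma : control_system X U}
  (Q : controlled_invariant_set Sigma).

Definition inclusion (x : Q) : X := set_val (x : set_type (carrier Q)).

Definition base_point : Q :=
  let x := cid (carrier_nonempty Q) in SigSub (mem_set (projT2 x)).

HB.instance Definition _ :=
  PseudoMetric.copy (points Q) (set_type (carrier Q)).
HB.instance Definition _ := isPointed.Build (points Q) base_point.

End Points.

Notation borelType T := (g_sigma_algebraType (@open T)).

(* The number of cells is written [ncells_pred.+1]: a partition of the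
   nonempty set Q has at least one cell. *)
Record invariant_partition (R : realType) (X U : metricType R)
    (Sigma : control_system X U) (Q : controlled_invariant_set Sigma) :=
    InvariantPartition {
  ncells_pred : nat;
  cell : 'I_ncells_pred.+1 -> set Q;
  cell_partition : partition [set: 'I_ncells_pred.+1] cell [set: Q];
  cell_borel : forall i, measurable (cell i : set (borelType Q));
  tau : nat;
  tau_gt0 : (0 < tau)%N;
  nu : 'I_ncells_pred.+1 -> tau.-tuple U;
  cell_invariant : forall i (x : Q) j, cell i x -> (j <= tau)%N ->
    carrier Q (phi Sigma j (inclusion x) (nu i)) }.

Arguments cell {R X U Sigma Q} C i : rename.
Arguments nu {R X U Sigma Q} C i : rename.

Section Partition.
Context {R : realType} {X U : metricType R} {Sigma : control_system X U}
  {Q : controlled_invariant_set Sigma} (C : invariant_partition Q).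

Local Notation S := 'I_(ncells_pred C).+1.

Definition clopen_partition : Prop := forall i, clopen (cell C i).

Definition control_word (s : seq S) : seq U :=
  flatten [seq tval (nu C i) | i <- s].

(* Only the first [j] symbols of [s] matter for the state at time [j * tau]. *)
Definition is_itinerary (x : Q) (s : nat -> S) : Prop :=
  forall j, (@inclusion _ _ _ _ Q @` cell C (s j))
    (phi Sigma (j * tau C) (inclusion x) (control_word (mkseq s j))).

Definition itinerary (x : Q) : nat -> S :=
  xget (fun=> ord0) [set s | is_itinerary x s].

Lemma size_control_word (s : seq S) :
  size (control_word s) = (size s * tau C)%N.
Proof.
elim: s => [|i s IH] //=; rewrite /control_word /= size_cat size_tuple.
by rewrite -/(control_word s) IH mulSn.
Qed.

Lemma cell_exists (y : Q) : exists i, cell C i y.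
Proof.
have [cov _ _] := cell_partition C.
have : [set: Q] y by [].
by rewrite -cov => -[i _ iy]; exists i.
Qed.

Lemma cell_unique (y : Q) i j : cell C i y -> cell C j y -> i = j.
Proof.
by have [_ tr _] := cell_partition C => iy jy; apply: tr => //; exists y.
Qed.

Lemma is_itinerary_unique x s t :
  is_itinerary x s -> is_itinerary x t -> s = t.
Proof.
move=> sx tx; apply/funext => j; elim/ltn_ind: j => j IH.
have E : mkseq s j = mkseq t j.
  apply: (@eq_from_nth _ ord0); rewrite ?size_mkseq // => k kj.
  by rewrite !nth_mkseq // IH.
have := sx j; have := tx j; rewrite E => -[y ty <-] [z sz].
rewrite /inclusion => /val_inj zy; rewrite zy in sz.
exact: cell_unique sz ty.
Qed.

Lemma is_itinerary_exists x : exists s, is_itinerary x s.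
Proof.
pose idx y := projT1 (cid (cell_exists y)).
have step (y : Q) : exists z : Q, inclusion z =
    foldl (transition Sigma) (inclusion y) (nu C (idx y)).
  have := cell_invariant (projT2 (cid (cell_exists y))) (leqnn _).
  rewrite /phi take_oversize ?size_tuple // => Qz.
  by exists (SigSub (mem_set Qz)).
pose y j := iter j (fun y => projT1 (cid (step y))) x.
exists (fun j => idx (y j)) => j.
exists (y j); first exact: (projT2 (cid (cell_exists (y j)))).
rewrite /phi take_oversize ?size_control_word ?size_mkseq //.
elim: j => [|j IH] //.
rewrite mkseqS /control_word map_rcons flatten_rcons foldl_cat.
rewrite -/(control_word _) -IH; exact: (projT2 (cid (step (y j)))).
Qed.

Lemma itineraryP x : is_itinerary x (itinerary x).
Proof. by have [s sx] := is_itinerary_exists x; exact: (xgetI _ sx). Qed.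

Definition itinerary_prefix (n : nat) (x : Q) : seq S := mkseq (itinerary x) n.

Definition cylinder (n : nat) (x : Q) : set Q :=
  [set y | forall j, (j < n)%N -> itinerary y j = itinerary x j].

Definition birkhoff_sum (f : U -> R) (w : seq U) : R := \sum_(u <- w) f u.

(* S_{n tau} f (omega_{C_[0,n)(x)}) *)
Definition cost (f : U -> R) (n : nat) (x : Q) : R :=
  birkhoff_sum f (control_word (itinerary_prefix n x)).

Local Open Scope ereal_scope.

(* Finite or countable families are indexed by an arbitrary [I : set nat]. *)
Definition BS_premeasure_at (f : U -> R) (Z : set Q) (lambda : R) (N : nat) :
    \bar R :=
  ereal_inf [set s | exists (I : set nat) (n : nat -> nat) (x : nat -> Q),
    [/\ forall i, I i -> (N <= n i)%N,
        Z `<=` \bigcup_(i in I) cylinder (n i) (x i) &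
        s = \esum_(i in I) (expR (- lambda * cost f (n i) (x i)))%:E]].

Definition BS_premeasure (f : U -> R) (Z : set Q) (lambda : R) : \bar R :=
  limn (BS_premeasure_at f Z lambda).

Definition BS_dim (f : U -> R) (Z : set Q) : \bar R :=
  ereal_inf [set lambda%:E | lambda in [set l : R | BS_premeasure f Z l = 0]].

(* [lne 0 = -oo], so a null cylinder contributes [+oo]; the index [n = 0],
   where the cost vanishes, is irrelevant to the limit inferior. *)
Definition lower_BS_pressure (f : U -> R) (mu : probability (borelType Q) R) :
    \bar R :=
  \int[mu]_x limn_einf (fun n => - lne (mu (cylinder n x)) / (cost f n x)%:E).

End Partition.

Arguments control_word {R X U Sigma Q} C s.
Arguments is_itinerary {R X U Sigma Q} C x s.

(* Main.v *)
(** If the premeasure vanishes at [lambda], then for every [mu] the set of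
    points all of whose long cylinders satisfy
    [mu (Q_n(x)) <= expR (- lambda * cost)] is covered by cylinders of
    arbitrarily small total weight, hence null; so the local lower pressure is
    at most [lambda] almost everywhere.

    Conversely, for [lambda] below the dimension, some truncated premeasure [M]
    (built from finite covers) satisfies [M K > 0].  Order the cylinders of
    level [n] lexicographically.  Since [M] is subadditive, the intervals
    between [M (cylinders < w)] and [M (cylinders <= w)] have length at most
    [M w], and they are nested as [n] grows.  A real number between 0 and [M K]
    thus selects a decreasing sequence of nonempty compact sets (cylinders meet
    [K]); a measurable selection in their intersection pushes the normalized
    Lebesgue measure to a probability on [K] giving the cylinder [w] mass at
    most [M w / M K]: a Frostman measure without Hahn-Banach or weak limits. *)

Require Import Defs.
From HB Require Import structures.
From mathcomp Require Import all_boot all_order all_algebra.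
From mathcomp Require Import all_classical all_reals all_analysis.
From mathcomp Require Import measurable_realfun lra.

Set Implicit Arguments.
Unset Strict Implicit.
Unset Printing Implicit Defensive.

Import Order.TTheory GRing.Theory Num.Theory.
Import numFieldNormedType.Exports.

Local Open Scope classical_set_scope.
Local Open Scope ring_scope.

(** * Measurable selection from nested closed sets *)

(** Points chosen in the successive sets have a cluster point, and each closed set contains a tail
    of the chosen sequence. *)
Lemma nested_closed_nonempty {T : topologicalType} (F : nat -> set T) :
  compact [set: T] -> (forall n, closed (F n)) -> (forall n, F n !=set0) ->
  (forall n, F n.+1 `<=` F n) -> \bigcap_n F n !=set0.
Proof.
move=> cT clF F0 decF.
have le_F m n : (m <= n)%N -> F n `<=` F m.
  elim: n => [|n IH]; first by rewrite leqn0 => /eqP ->.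
  rewrite leq_eqVlt => /predU1P[->//|/IH mn].
  exact: subset_trans (decF n) mn.
pose x n := projT1 (cid (F0 n)).
have Fx n : F n (x n) := projT2 (cid (F0 n)).
have [//|p [_ clp]] := cT (x @ \oo) _; first exact: filterT.
exists p => n _; apply: clF => B Bp.
have [|q [Fq Bq]] := clp (F n) B _ Bp; last by exists q.
by exists n => //= m nm; exact: le_F nm _ (Fx m).
Qed.

(** Closures of basic open sets suffice: regularity leaves room for a closed neighbourhood inside
    any open neighbourhood. *)
Lemma second_countable_closed_network {T : topologicalType} :
  second_countable (T := T) -> regular_space T ->
  exists B : nat -> set T, (forall j, closed (B j)) /\
    forall (p : T) (O : set T), open O -> O p ->
      exists2 j, B j p & B j `<=` O.
Proof.
move=> [V /countable_injP[f injf] [oV bV]] regT.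
exists (fun j => closure (xget setT [set U | V U /\ f U = j])).
split=> [j|p O oO Op]; first exact: closed_closure.
have [W Wp clW] := regT p O (open_nbhs_nbhs (conj oO Op)).
have [U [VU Up] UW] := bV p W Wp.
exists (f U).
- apply: subset_closure; case: xgetP => [U' _ [VU' e]|/(_ U)[]//].
  by have -> : U' = U by apply: injf => //; rewrite inE.
- case: xgetP => [U' _ [VU' e]|/(_ U)[]//].
  have -> : U' = U by apply: injf => //; rewrite inE.
  exact: subset_trans (closureS UW) clW.
Qed.

Section MeasurableSelection.
Context {T : ptopologicalType} {d} {Om : measurableType d}.
Variables (A : nat -> Om -> set T) (B : nat -> set T).

(* The limit of this sequence lies in [B j] exactly when stage [j] meets [B j],
   a condition that depends measurably on [u]. *)
Fixpoint shrink (j : nat) (u : Om) : set T :=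
  if j is j'.+1 then
    if `[< shrink j' u `&` B j' !=set0 >] then shrink j' u `&` B j'
    else shrink j' u
  else \bigcap_n A n u.

Hypothesis cT : compact [set: T].
Hypothesis clA : forall n u, closed (A n u).
Hypothesis A0 : forall n u, A n u !=set0.
Hypothesis decA : forall n u, A n.+1 u `<=` A n u.
Hypothesis mA : forall n D, closed D -> measurable [set u | A n u `&` D !=set0].
Hypothesis clB : forall j, closed (B j).

Lemma shrink_decreasing j u : shrink j.+1 u `<=` shrink j u.
Proof. by move=> x /=; case: asboolP => // _ []. Qed.

Lemma shrink_closed j u : closed (shrink j u).
Proof.
elim: j => [|j IH] /=; first by apply: closed_bigI => n _; exact: clA.
by case: asboolP => [_|//]; exact: closedI.
Qed.

Lemma shrink_nonempty j u : shrink j u !=set0.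
Proof.
elim: j => [|j IH] /=; last by case: asboolP.
exact: nested_closed_nonempty.
Qed.

(** By compactness the intersection of the [A n u] meets [D] iff every [A n u] does. A later stage
    reduces to the preceding one tested against [B j], [D] and their intersection, so the induction
    must carry all closed [D]. *)
Lemma shrink_measurable j D : closed D ->
  measurable [set u | shrink j u `&` D !=set0].
Proof.
elim: j D => [|j IH] D clD.
  rewrite [X in measurable X](_ : _ = \bigcap_n [set u | A n u `&` D !=set0]).
    by apply: bigcapT_measurable => n; exact: mA.
  apply/seteqP; split=> u /=.
    by move=> [x [Ax Dx]] n _; exists x; split=> //; exact: Ax.
  move=> AD.
  have [] := @nested_closed_nonempty _ (fun n => A n u `&` D) cT.
  - by move=> n; exact: closedI.
  - by move=> n; exact: AD.
  - by move=> n; exact: setSI.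
  - move=> x Ax; exists x; split; last by have [] := Ax 0%N I.
    by move=> n _; have [] := Ax n I.
rewrite [X in measurable X](_ : _ =
  ([set u | shrink j u `&` B j !=set0] `&`
   [set u | shrink j u `&` (B j `&` D) !=set0]) `|`
  (~` [set u | shrink j u `&` B j !=set0] `&`
   [set u | shrink j u `&` D !=set0])).
  apply: measurableU; apply: measurableI; try apply: measurableC; apply: IH => //.
  exact: closedI.
apply/seteqP; split=> u /=.
  by case: asboolP => [h|h] ?; [left|right]; split=> //; rewrite setIA.
by case: asboolP => [h|h] [[]|[]] //; rewrite setIA.
Qed.

Lemma limit_shrink_nonempty u : \bigcap_i shrink i u !=set0.
Proof.
apply: nested_closed_nonempty => // j.
- exact: shrink_closed.
- exact: shrink_nonempty.
- exact: shrink_decreasing.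
Qed.

End MeasurableSelection.

(** The preimage of an open [V] is the union, over the [B j] inside [V], of the events that stage
    [j] meets [B j]: such an event forces the limit into [B j], and conversely a limit in [B j] lies
    in stage [j]. *)
Lemma measurable_selection {T : ptopologicalType} {d} {Om : measurableType d}
    (A : nat -> Om -> set T) :
  compact [set: T] -> regular_space T -> second_countable (T := T) ->
  (forall n u, closed (A n u)) -> (forall n u, A n u !=set0) ->
  (forall n u, A n.+1 u `<=` A n u) ->
  (forall n D, closed D -> measurable [set u | A n u `&` D !=set0]) ->
  exists2 g : Om -> borelType T, measurable_fun [set: Om] g &
    forall n u, A n u (g u).
Proof.
move=> cT rT scT clA A0 decA mA.
have [B [clB netB]] := second_countable_closed_network scT rT.
have F0 u := limit_shrink_nonempty cT clA A0 decA clB u.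
pose g u : borelType T := projT1 (cid (F0 u)).
have Fg u : (\bigcap_i shrink A B i u) (g u) := projT2 (cid (F0 u)).
exists g => [|n u]; last exact: Fg u 0%N I n I.
apply: (@measurability _ _ Om (borelType T) setT g (@open T)) => // _ [V oV <-].
rewrite setTI [X in measurable X](_ : _ = \bigcup_(j in [set j | B j `<=` V])
    [set u | shrink A B j u `&` B j !=set0]).
  by apply: bigcup_measurable => j _; exact: shrink_measurable.
apply/seteqP; split=> u /=.
  move=> Vu; have [j Bj BV] := netB (g u) V oV Vu.
  by exists j => //; exists (g u); split=> //; exact: Fg.
move=> [j BV FB]; apply: BV; have := Fg u j.+1 I => /=.
by case: asboolP => // _ [].
Qed.

(** * Frostman measures *)

Section OrderedCylinderMeasure.
Context {R : realType} {T : ptopologicalType}.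
Variables (K : set T) (code : nat -> T -> nat) (M : set T -> R).
Hypothesis cT : compact [set: T].
Hypothesis rT : regular_space T.
Hypothesis scT : second_countable (T := T).
Hypothesis clK : closed K.
Hypothesis code_open : forall n k, open [set x | code n x = k].
Hypothesis code_bounded : forall n, exists b, forall x, (code n x < b)%N.
Hypothesis code_refines : forall n x y,
  (code n.+1 x <= code n.+1 y)%N -> (code n x <= code n y)%N.
Hypothesis M0 : M set0 = 0.
Hypothesis le_M : forall A B, A `<=` B -> M A <= M B.
Hypothesis MU : forall A B, M (A `|` B) <= M A + M B.
Hypothesis MK_gt0 : 0 < M K.

Let cdf n k := M (K `&` [set x | (code n x < k)%N]).

(* For [0 <= u < M K] this is the intersection of [K] with the only cylinder of
   level [n] whose interval [cdf k, cdf k.+1[ contains [u]. *)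
Let slice n (u : R) : set T := [set x | K x /\
  (u \in `[0, M K[ -> u \in `[cdf n (code n x), cdf n (code n x).+1[)].

Let code_clopen n (P : set nat) : clopen [set x | P (code n x)].
Proof.
have opn (S : set nat) : open [set x | S (code n x)].
  rewrite (_ : [set x | _] = \bigcup_(k in S) [set x | code n x = k]).
    by apply: bigcup_open => k _; exact: code_open.
  by apply/seteqP; split=> x /=; [exists (code n x)|move=> [k Sk ->]].
split=> //; rewrite -[X in closed X]setCK; apply: open_closedC.
exact: (opn (~` P)).
Qed.

Let slice_closed n u : closed (slice n u).
Proof.
apply: closedI => //; exact: (code_clopen n (fun k =>
  u \in `[0, M K[ -> u \in `[cdf n k, cdf n k.+1[)).2.
Qed.

(** For [u] outside [[0, M K[] the slice is all of [K], nonempty because [M set0 = 0 < M K]. *)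
Let slice_nonempty n u : slice n u !=set0.
Proof.
have [uI|uI] := boolP (u \in `[0, M K[); last first.
  have [[x Kx]|K0] := pselect (K !=set0); last first.
    have [Ke|/set0P/K0] := eqVneq K set0; last by [].
    by move: MK_gt0; rewrite Ke M0 ltxx.
  by exists x; split=> //; rewrite (negPf uI).
have [b code_b] := code_bounded n.
have ex : exists k, u < cdf n k.
  exists b; move: uI; rewrite in_itv /= => /andP[_ /lt_le_trans]; apply.
  by apply: le_M => x Kx; split=> //=; exact: code_b.
(* The least index at which [cdf n] exceeds [u] is some [k.+1], as [cdf n 0 = 0]. The code [k] is
   attained on [K], since otherwise [cdf n] would not grow from [k] to [k.+1]. *)
case: (ex_minnP ex) => -[|k] uk mink.
  suff: cdf n 0 <= u by rewrite leNgt uk.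
  rewrite /cdf (_ : _ `&` _ = set0) ?M0; last by apply/seteqP; split=> x [].
  by move: uI; rewrite in_itv /= => /andP[].
have ku : cdf n k <= u by rewrite leNgt; apply/negP => /mink; rewrite ltnn.
have [[x [Kx xk]]|noK] := pselect (exists x, K x /\ code n x = k).
  by exists x; split=> // _; rewrite in_itv /= xk ku uk.
suff : cdf n k.+1 <= cdf n k by rewrite leNgt (le_lt_trans ku uk).
apply: le_M => x [Kx /=]; rewrite ltnS leq_eqVlt => /predU1P[xk|//].
by case: noK; exists x.
Qed.

(** A smaller code at level [n] forces a smaller code at level [n.+1], so monotonicity of [M] places
    each fine interval inside the coarse one. *)
Let slice_decreasing n u : slice n.+1 u `<=` slice n u.
Proof.
move=> x [Kx Ix]; split=> // /Ix; rewrite !in_itv /= => /andP[lo hi].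
apply/andP; split.
  apply: le_trans lo; apply: le_M => y [Ky /= yx]; split=> //=; move: yx.
  by rewrite !ltnNge; apply: contra; exact: code_refines.
apply: (lt_le_trans hi); apply: le_M => y [Ky /= yx]; split=> //=; move: yx.
by rewrite !ltnS; exact: code_refines.
Qed.

Let slice_measurable n D : closed D ->
  measurable [set u : measurableTypeR R | slice n u `&` D !=set0].
Proof.
move=> _; rewrite [X in measurable X](_ : _ =
  \bigcup_(k in [set k | exists x, [/\ K x, D x & code n x = k]])
    (~` `[0, M K[ `|` `[cdf n k, cdf n k.+1[)).
  apply: bigcup_measurable => k _; apply: measurableU.
    by apply: measurableC; exact: measurable_itv.
  exact: measurable_itv.
apply/seteqP; split=> u /=.
  move=> [x [[Kx ux] Dx]]; exists (code n x); first by exists x.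
  by have [/ux|/negP] := boolP (u \in `[0, M K[); [right|left].
move=> [_ [x [Kx Dx <-]] ux]; exists x; split=> //; split=> // uI.
by case: ux => //=; rewrite uI.
Qed.

(** Take the image of normalized Lebesgue measure on [[0, M K[] under a selection [g] from the
    slices: the [u] sent to the cylinder [k] lie in [[cdf n k, cdf n k.+1[], whose length is bounded
    by subadditivity of [M]. *)
Lemma ordered_cylinder_measure : exists mu : probability (borelType T) R,
  mu K = 1%E /\ forall n k,
    (mu [set x | code n x = k] <= (M [set x | code n x = k] / M K)%:E)%E.
Proof.
have [g mg gA] := measurable_selection
  (Om := measurableTypeR R) cT rT scT slice_closed slice_nonempty
  slice_decreasing slice_measurable.
pose X : {mfun measurableTypeR R >-> borelType T} :=
  HB.pack g (isMeasurableFun.Build _ _ _ _ g mg).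
pose I : set (measurableTypeR R) := `[0, M K[%classic.
have mI : measurable I by exact: measurable_itv.
(* The Dirac mass is the default of [mnormalize] for a null or infinite measure; here the total mass
   is [M K]. *)
pose P : probability (measurableTypeR R) R := mnormalize (mrestr (@lebesgue_measure R) mI) 
  (@dirac _ (measurableTypeR R) (0 : R) R).
have PE S : P S = ((@lebesgue_measure R) (S `&` I) * (M K)^-1%:E)%E.
  have IE : @lebesgue_measure R I = (M K)%:E.
    by rewrite lebesgue_measure_itv /= lte_fin MK_gt0 oppr0 addr0.
  by rewrite /P /= /mnormalize /= /mrestr !setTI IE /= eqe gt_eqF.
exists (distribution P X); split=> [|n k].
  rewrite /distribution /pushforward /= (_ : _ @^-1` _ = [set: _]).
    exact: probability_setT.
  by apply/seteqP; split=> // u _; have [] := gA 0%N u.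
rewrite /distribution /pushforward /=; rewrite [leLHS]PE EFinM.
apply: lee_wpmul2r; first by rewrite lee_fin invr_ge0 ltW.
apply: (@le_trans _ _ (@lebesgue_measure R `[cdf n k, cdf n k.+1[%classic)).
  apply: le_measure; rewrite ?inE.
  - apply: measurableI => //; rewrite -[_ @^-1` _]setTI; apply: (mg) => //.
    by apply: sub_sigma_algebra; exact: code_open.
  - exact: measurable_itv.
  - by move=> u [/= gk uI]; have [_ /(_ uI)] := gA n u; rewrite gk.
have le_cdf : cdf n k.+1 <= cdf n k + M [set x | code n x = k].
  apply: le_trans (MU _ _); apply: le_M => x [Kx /=].
  by rewrite ltnS leq_eqVlt => /predU1P[->|xk]; [right|left].
rewrite lebesgue_measure_itv /= lte_fin; case: ifP => _.
  by rewrite EFinN -EFinD lee_fin lerBlDl.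
by rewrite lee_fin -[leLHS]M0; exact: le_M.
Qed.

End OrderedCylinderMeasure.

(** * Comparisons and limits inferior of extended reals *)

Lemma lee_fin_below {R : realFieldType} (x y : \bar R) :
  (forall r : R, (r%:E < x -> r%:E <= y)%E) -> (x <= y)%E.
Proof.
case: x => [x| |] lt_le; last by rewrite leNye.
- case: y lt_le => [y| |] lt_le; rewrite ?leey //.
    rewrite lee_fin leNgt; apply/negP => yx.
    have := lt_le ((y + x) / 2); rewrite lte_fin lee_fin.
    by rewrite (midf_lt yx).2 => /(_ isT); rewrite leNgt (midf_lt yx).1.
  by have := lt_le (x - 1); rewrite lte_fin ltrBlDr ltrDl ltr01 => /(_ isT).
- case: y lt_le => [y| |] lt_le //.
    have := lt_le (y + 1) (ltry _); rewrite lee_fin -subr_ge0 opprD addrA subrr.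
    by rewrite sub0r oppr_ge0 ler10.
  by have := lt_le 0 (ltry _).
Qed.

Lemma limn_einf_ge {R : realType} (u : (\bar R)^nat) (l : \bar R) :
  (\forall n \near \oo, (l <= u n)%E) -> (l <= limn_einf u)%E.
Proof.
move=> [N _ Nl]; rewrite limn_einf_lim; apply: lime_ge; first exact: is_cvg_einfs.
exists N => // n /= Nn; apply: le_ereal_inf_tmp => _ [m /= nm <-].
by apply: Nl => /=; exact: leq_trans nm.
Qed.

Lemma near_lt_limn_einf {R : realType} (u : (\bar R)^nat) (l : \bar R) :
  (l < limn_einf u)%E -> \forall n \near \oo, (l < u n)%E.
Proof.
rewrite limn_einf_lim (cvg_lim _ (@cvg_einfs_sup _ u)) // => l_sup.
have [_ [N _ <-] lN] := ereal_sup_gt l_sup.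
exists N => // n /= Nn; apply: (lt_le_trans lN).
by apply: ereal_inf_lbound; exists n.
Qed.

(** * Cylinders of an invariant partition *)

Section InvariantSet.
Context {R : realType} {X U : metricType R} {Sigma : control_system X U}
  (Q : controlled_invariant_set Sigma).

Lemma inclusion_carrier (x : Q) : carrier Q (inclusion x).
Proof. exact: set_valP. Qed.

Lemma inclusion_continuous : continuous (@inclusion _ _ _ _ Q).
Proof. exact: initial_continuous. Qed.

Lemma inclusion_openP (A : set Q) : open A ->
  exists2 V : set X, open V & A = @inclusion _ _ _ _ Q @^-1` V.
Proof. by move=> [V oV <-]; exists V. Qed.

Lemma points_hausdorff : hausdorff_space Q.
Proof.
move=> x y xy; apply: val_inj.
apply: (@metric_hausdorff _ X) => A B xA yB.
have [z [Az Bz]] := xy _ _ (inclusion_continuous xA) (inclusion_continuous yB).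
by exists (inclusion z).
Qed.

(** A filter on [Q] is pushed into [X]; its image has a cluster point in the compact carrier, and
    open sets of [Q] are traces of open sets of [X]. *)
Lemma points_compact : compact [set: Q].
Proof.
move=> F PF _.
have [|p [Qp clp]] := @carrier_compact _ _ _ _ Q (@inclusion _ _ _ _ Q @ F) _.
  by apply: (@filterS _ F _ setT) => [x _|]; [exact: inclusion_carrier|exact: filterT].
exists (SigSub (mem_set Qp) : set_type (carrier Q)); split=> // A B FA.
rewrite nbhsE => -[W [oW Wp] WB].
have [V oV WV] := inclusion_openP oW.
have [||_ [[a Aa <-] Va]] := clp (@inclusion _ _ _ _ Q @` A) V.
- by apply: (@filterS _ F _ A) => // a Aa; exists a.
- by apply: open_nbhs_nbhs; split=> //; move: Wp; rewrite WV.
- by exists a; split=> //; apply: WB; rewrite WV.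
Qed.

Lemma points_second_countable : second_countable (T := Q).
Proof. exact: (@compact_second_countable R Q points_compact). Qed.

End InvariantSet.

Section Cylinders.
Context {R : realType} {X U : metricType R} {Sigma : control_system X U}
  {Q : controlled_invariant_set Sigma} (C : invariant_partition Q).

Lemma cylinder_eq n (x y : Q) : cylinder C n x y -> cylinder C n y = cylinder C n x.
Proof.
by move=> xy; apply/seteqP; split=> z zc j jn; rewrite zc // xy.
Qed.

Lemma itinerary_prefix_eq n (x y : Q) : cylinder C n x y ->
  itinerary_prefix C n y = itinerary_prefix C n x.
Proof.
move=> xy; apply: (@eq_from_nth _ ord0); rewrite !size_mkseq // => j jn.
by rewrite !nth_mkseq // xy.
Qed.

Lemma cost_eq (f : U -> R) n (x y : Q) : cylinder C n x y ->
  cost C f n y = cost C f n x.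
Proof. by move=> xy; rewrite /cost (itinerary_prefix_eq xy). Qed.

Lemma foldl_transition_continuous (w : seq U) :
  continuous (fun x : X => foldl (transition Sigma) x w).
Proof.
elim: w => [|u w IH] x; first exact: cvg_id.
exact: (@continuous_comp _ _ _ (transition Sigma ^~ u)
  (foldl (transition Sigma) ^~ w) x (@transition_continuous _ _ _ Sigma u x)
  (IH _)).
Qed.

(** On a cylinder of length [n] the control word is constant, so the state at time [n * tau] depends
    continuously on the point; the next symbol is fixed by requiring that state to lie in an open
    cell. *)
Lemma cylinder_open (C_clopen : clopen_partition C) n (x : Q) :
  open (cylinder C n x).
Proof.
elim: n => [|n IH].
  by rewrite (_ : cylinder C 0 x = setT); [exact: openT|apply/seteqP; split].
have [V oV cellV] := inclusion_openP (C_clopen (itinerary C x n)).1.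
pose w := control_word C (itinerary_prefix C n x).
pose state (y : Q) := foldl (transition Sigma) (inclusion y) w.
have stateE y : cylinder C n x y -> exists2 z : Q,
    cell C (itinerary C y n) z & inclusion z = state y.
  move=> xy; have [z yz zE] := itineraryP C y n; exists z => //.
  rewrite zE /phi take_oversize ?size_control_word ?size_mkseq //.
  by rewrite -/(itinerary_prefix C n y) (itinerary_prefix_eq xy).
rewrite (_ : cylinder C n.+1 x = cylinder C n x `&` (state @^-1` V)).
  apply: openI => //; have /continuousP : continuous state; last exact.
  move=> y; exact: (@continuous_comp _ _ _ (@inclusion _ _ _ _ Q)
    (foldl (transition Sigma) ^~ w) y (@inclusion_continuous _ _ _ _ Q y)
    (@foldl_transition_continuous w _)).
apply/seteqP; split=> y.
  move=> xy; have xyn : cylinder C n x y by move=> j jn; apply: xy; rewrite ltnW.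
  split=> //=; have [z + <-] := stateE y xyn.
  by rewrite xy // cellV.
move=> [xy /=]; have [z yz <-] := stateE y xy => Vz j.
rewrite ltnS leq_eqVlt => /predU1P[->|]; last exact: xy.
by apply: cell_unique yz _; rewrite cellV.
Qed.

(** Such a set is a union of cylinders. This yields measurability of everything that depends on the
    first [n] symbols only. *)
Lemma cylinder_invariant_open (C_clopen : clopen_partition C) n (P : set Q) :
  (forall x y, cylinder C n x y -> P x -> P y) -> open P.
Proof.
move=> invP; rewrite (_ : P = \bigcup_(x in P) cylinder C n x).
  by apply: bigcup_open => x _; exact: cylinder_open.
apply/seteqP; split=> [x Px|x [y Py yx]]; first by exists x.
exact: invP yx Py.
Qed.

(** The itinerary read as a numeral whose base is the number of cells, first symbol most
    significant: numerical order is lexicographic, and division by the base drops the last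
    symbol. *)
Definition cylinder_code (n : nat) (x : Q) : nat :=
  iteri n (fun j c => c * (ncells_pred C).+1 + itinerary C x j)%N 0%N.

Lemma cylinder_code_div n (x : Q) :
  (cylinder_code n.+1 x %/ (ncells_pred C).+1)%N = cylinder_code n x.
Proof.
by rewrite /cylinder_code iteriS divnMDl // (divn_small (ltn_ord _)) addn0.
Qed.

Lemma cylinder_code_mod n (x : Q) :
  (cylinder_code n.+1 x %% (ncells_pred C).+1)%N = itinerary C x n.
Proof. by rewrite /cylinder_code iteriS modnMDl modn_small. Qed.

Lemma cylinder_codeP n (x y : Q) :
  cylinder_code n y = cylinder_code n x <-> cylinder C n x y.
Proof.
elim: n => [|n IH]; first by split.
split=> [eqc j|xy].
  rewrite ltnS leq_eqVlt => /predU1P[->|].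
    by apply: val_inj; rewrite /= -!cylinder_code_mod eqc.
  by move: j; apply/IH; rewrite -(cylinder_code_div n y) eqc cylinder_code_div.
rewrite /cylinder_code !iteriS -!/(cylinder_code n _) xy //.
by congr (_ * _ + _)%N; apply/IH => j jn; apply: xy; exact: ltnW.
Qed.

Lemma cylinder_code_bounded n (x : Q) :
  (cylinder_code n x < (ncells_pred C).+1 ^ n)%N.
Proof.
elim: n => [|n IH]; first by rewrite expn0.
by rewrite expnSr -ltn_divLR // cylinder_code_div.
Qed.

End Cylinders.

(** * Premeasures and finite covers *)

Section Cost.
Context {R : realType} {X U : metricType R} {Sigma : control_system X U}
  {Q : controlled_invariant_set Sigma} (C : invariant_partition Q).
Variable f : U -> R.
Hypothesis f_gt0 : forall u, 0 < f u.

Lemma costS n (x : Q) :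
  cost C f n.+1 x = cost C f n x + birkhoff_sum f (nu C (itinerary C x n)).
Proof.
rewrite /cost /itinerary_prefix mkseqS /control_word map_rcons flatten_rcons.
exact: big_cat.
Qed.

Lemma birkhoff_sum_gt0 (w : seq U) : (0 < size w)%N -> 0 < birkhoff_sum f w.
Proof.
case: w => // u w _; rewrite /birkhoff_sum big_cons ltr_pwDl //.
by apply: sumr_ge0 => v _; exact: ltW.
Qed.

(** Each symbol adds at least the cheapest block cost, a minimum over finitely many cells, positive
    because blocks have length [tau > 0]. *)
Lemma cost_linear_growth :
  exists2 c : R, 0 < c & forall n (x : Q), n%:R * c <= cost C f n x.
Proof.
pose i := [arg min_(i < ord0) birkhoff_sum f (nu C i)]%O.
exists (birkhoff_sum f (nu C i)).
  by apply: birkhoff_sum_gt0; rewrite size_tuple tau_gt0.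
move=> n x; elim: n => [|n IH].
  by rewrite mul0r /cost /birkhoff_sum big_nil.
rewrite costS -addn1 natrD mulrDl mul1r lerD // /i.
by case: arg_minP => // j _; exact.
Qed.

Lemma cost_gt0 n (x : Q) : (0 < n)%N -> 0 < cost C f n x.
Proof.
move=> n0; have [c c0 /(_ n x)] := cost_linear_growth.
by apply: lt_le_trans; rewrite mulr_gt0 // ltr0n.
Qed.

Lemma cost_ge0 n (x : Q) : 0 <= cost C f n x.
Proof.
by case: n => [|n]; [rewrite /cost /birkhoff_sum big_nil|exact/ltW/cost_gt0].
Qed.

Section Premeasure.
Variables (K : set Q) (lambda : R).

Local Open Scope ereal_scope.

Lemma BS_premeasure_at_ge0 N : 0 <= BS_premeasure_at C f K lambda N.
Proof.
apply: le_ereal_inf_tmp => _ [I [n [x [_ _ ->]]]].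
by apply: esum_ge0 => i _; rewrite lee_fin expR_ge0.
Qed.

Lemma nondecreasing_BS_premeasure_at :
  nondecreasing_seq (BS_premeasure_at C f K lambda).
Proof.
move=> N N' NN'; apply: ereal_inf_le_tmp => s [I [n [x [nN' KI ->]]]].
by exists I, n, x; split=> // i /nN'; exact: leq_trans.
Qed.

Lemma BS_premeasureE :
  BS_premeasure C f K lambda = ereal_sup (range (BS_premeasure_at C f K lambda)).
Proof.
apply/cvg_lim => //.
exact: ereal_nondecreasing_cvgn nondecreasing_BS_premeasure_at.
Qed.

Lemma BS_premeasure_eq0P :
  BS_premeasure C f K lambda = 0 <->
  forall N, BS_premeasure_at C f K lambda N = 0.
Proof.
rewrite BS_premeasureE; split=> [sup0 N|R0].
  apply/eqP; rewrite eq_le BS_premeasure_at_ge0 andbT -sup0.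
  by apply: ereal_sup_ubound; exists N.
rewrite (_ : range _ = [set 0]) ?ereal_sup1 //; apply/seteqP; split=> s /=.
  by move=> [N _ <-].
by move=> ->; exists 0%N.
Qed.

End Premeasure.

Lemma BS_dim_le (K : set Q) (lambda : R) :
  BS_premeasure C f K lambda = 0%E -> (BS_dim C f K <= lambda%:E)%E.
Proof. by move=> R0; apply: ereal_inf_lbound; exists lambda. Qed.

End Cost.

Section FiniteCovers.
Context {R : realType} {X U : metricType R} {Sigma : control_system X U}
  {Q : controlled_invariant_set Sigma} (C : invariant_partition Q).
Variables (f : U -> R) (lambda : R) (N : nat).

(* Giving weight 1 to the short cylinders makes every set coverable without
   making the content of a set of positive premeasure vanish. *)
Definition cylinder_weight (p : nat * Q) : R :=
  if (p.1 < N)%N then 1 else expR (- lambda * cost C f p.1 p.2).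

Definition cover_weights (A : set Q) : set R :=
  [set s | exists2 L : seq (nat * Q),
    A `<=` [set y | exists2 p, p \in L & cylinder C p.1 p.2 y] &
    s = \sum_(p <- L) cylinder_weight p].

Definition cover_content (A : set Q) : R := inf (cover_weights A).

Lemma cylinder_weight_ge0 p : 0 <= cylinder_weight p.
Proof. by rewrite /cylinder_weight; case: ifP => // _; exact: expR_ge0. Qed.

(** A single cylinder of length 0 is the whole space, so the infimum defining the content is a
    genuine one. *)
Lemma cover_weights_nonempty A : cover_weights A !=set0.
Proof.
exists (\sum_(p <- [:: (0%N, point : Q)]) cylinder_weight p).
exists [:: (0%N, point : Q)] => // y _; exists (0%N, point : Q) => //.
exact: mem_head.
Qed.

Lemma cover_weights_lbound A : has_lbound (cover_weights A).
Proof.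
exists 0 => _ [L _ ->]; apply: sumr_ge0 => p _; exact: cylinder_weight_ge0.
Qed.

Lemma cover_content_le A s : cover_weights A s -> cover_content A <= s.
Proof. exact: (ge_inf (cover_weights_lbound A)). Qed.

Lemma cover_content0 : cover_content set0 = 0.
Proof.
apply/eqP; rewrite eq_le; apply/andP; split.
  by apply: cover_content_le; exists [::]; rewrite ?big_nil.
apply: lb_le_inf; first exact: cover_weights_nonempty.
by move=> _ [L _ ->]; apply: sumr_ge0 => p _; exact: cylinder_weight_ge0.
Qed.

Lemma le_cover_content A B : A `<=` B -> cover_content A <= cover_content B.
Proof.
move=> AB; apply: lb_le_inf; first exact: cover_weights_nonempty.
move=> _ [L BL ->]; apply: cover_content_le; exists L => //.
exact: subset_trans AB BL.
Qed.

Lemma cover_contentU A B :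
  cover_content (A `|` B) <= cover_content A + cover_content B.
Proof.
rewrite -lerBlDr; apply: lb_le_inf; first exact: cover_weights_nonempty.
move=> _ [L AL ->]; rewrite lerBlDr addrC -lerBlDr.
apply: lb_le_inf; first exact: cover_weights_nonempty.
move=> _ [L' BL' ->]; rewrite lerBlDr addrC; apply: cover_content_le.
exists (L ++ L'); last by rewrite big_cat.
move=> y [/AL|/BL'] [p pL py]; exists p => //; by rewrite mem_cat pL ?orbT.
Qed.

Lemma cover_content_cylinder n (x : Q) : (N <= n)%N ->
  cover_content (cylinder C n x) <= expR (- lambda * cost C f n x).
Proof.
move=> Nn; apply: cover_content_le; exists [:: (n, x)].
  by move=> y xy; exists (n, x); rewrite ?mem_head.
by rewrite big_seq1 /cylinder_weight /= ltnNge Nn.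
Qed.

(** A finite cover with a short cylinder weighs at least 1, and any other is admissible for the
    premeasure at [N]; the content is thus at least the minimum [r] of 1 and that premeasure. *)
Lemma cover_content_gt0 (K : set Q) :
  (0 < BS_premeasure_at C f K lambda N)%E -> 0 < cover_content K.
Proof.
move=> R0.
have [r [r0 r1 rR]] : exists r : R,
    [/\ 0 < r, r <= 1 & (r%:E <= BS_premeasure_at C f K lambda N)%E].
  case: (BS_premeasure_at _ _ _ _ _) R0 => [s|_|//].
    rewrite lte_fin => s0; exists (Num.min s 1).
    by rewrite lt_min s0 ltr01 ge_min lexx orbT lee_fin ge_min lexx.
  by exists 1; rewrite ltr01 lexx leey.
apply: (lt_le_trans r0); apply: lb_le_inf; first exact: cover_weights_nonempty.
move=> _ [L KL ->].
have [/hasP[p pL pN]|/hasPn noshort] := boolP (has (fun p => p.1 < N)%N L).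
  apply: (le_trans r1); rewrite (big_rem p) //= /cylinder_weight pN lerDl.
  by apply: sumr_ge0 => q _; exact: cylinder_weight_ge0.
rewrite -lee_fin; apply: (le_trans rR); apply: ereal_inf_lbound.
pose p i := nth (0%N, point : Q) L i.
exists `I_(size L), (fun i => (p i).1), (fun i => (p i).2); split.
- by move=> i iL; rewrite leqNgt; apply: noshort; exact: mem_nth.
- move=> y /KL[q qL qy]; exists (index q L); first by rewrite /= index_mem.
  by rewrite /p nth_index.
rewrite esum_fset //.
rewrite -fsbig_ord sumEFin; congr (_%:E); rewrite (big_nth (0%N, point : Q)).
rewrite big_mkord; apply: eq_bigr => i _.
by rewrite /cylinder_weight ifF //; apply/negbTE/noshort; exact: mem_nth.
Qed.

End FiniteCovers.

(** * Dimension and pressure *)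

Section Pressure.
Context {R : realType} {X U : metricType R} {Sigma : control_system X U}
  {Q : controlled_invariant_set Sigma} (C : invariant_partition Q).
Hypothesis C_clopen : clopen_partition C.
Variable f : U -> R.
Hypothesis f_gt0 : forall u, 0 < f u.
Implicit Type mu : probability (borelType Q) R.

Local Open Scope ereal_scope.

Let local_pressure mu n (x : Q) :=
  - lne (mu (cylinder C n x)) / (cost C f n x)%:E.

Lemma borel_open (A : set Q) : open A -> measurable (A : set (borelType Q)).
Proof. exact: sub_sigma_algebra. Qed.

Lemma measurable_cylinder n (x : Q) :
  measurable (cylinder C n x : set (borelType Q)).
Proof. by apply: borel_open; exact: cylinder_open. Qed.

Let local_pressure_ge0 mu n x : 0 <= local_pressure mu n x.
Proof.
apply: mule_ge0; last by rewrite inve_ge0 lee_fin cost_ge0.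
by rewrite oppe_ge0 lne_le0 probability_le1 //; exact: measurable_cylinder.
Qed.

Let limn_einf_local_pressure_ge0 mu x :
  0 <= limn_einf (fun n => local_pressure mu n x).
Proof. by apply: limn_einf_ge; exact: nearW. Qed.

(** For fixed [n] the local pressure is constant on cylinders of length [n], so all its preimages
    are open. *)
Let measurable_limn_einf_local_pressure mu :
  measurable_fun [set: borelType Q]
    ((fun x => limn_einf (fun n => local_pressure mu n x)) :
      borelType Q -> \bar R).
Proof.
apply: (measurableT_comp (f := -%E)) => //.
apply: measurable_fun_limn_esup => n _ B _.
rewrite setTI; apply: borel_open.
apply: (@cylinder_invariant_open _ _ _ _ _ _ C_clopen n) => x y xy /=.
by rewrite /local_pressure (cylinder_eq xy) (cost_eq f xy).
Qed.

(** * Pressure bounded by the dimension *)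

Lemma lt_local_pressure mu n x (lambda : R) : (0 < n)%N ->
  lambda%:E < local_pressure mu n x ->
  mu (cylinder C n x) <= (expR (- lambda * cost C f n x))%:E.
Proof.
move=> n0; have c0 := cost_gt0 C f_gt0 x n0.
rewrite /local_pressure inver gt_eqF // lte_pdivlMr // lteNr => ltlne.
have mu0 : 0 <= mu (cylinder C n x) by [].
rewrite -[leLHS](lneK _) ?in_itv /= ?leey ?andbT //.
rewrite -[leRHS]/(expeR (- lambda * cost C f n x)%:E) lee_expeR mulNr EFinN.
exact: ltW.
Qed.

(** A mass distribution argument: each covering cylinder that meets [E] can be recentred at a point
    of [E], where the bound applies, and countable subadditivity sums the bounds. *)
Lemma measure_le_BS_premeasure_at mu (E : set Q) (lambda : R) N :
  measurable (E : set (borelType Q)) ->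
  (forall n x, (N <= n)%N -> E x ->
    mu (cylinder C n x) <= (expR (- lambda * cost C f n x))%:E) ->
  mu E <= BS_premeasure_at C f E lambda N.
Proof.
move=> mE smallE; apply: le_ereal_inf_tmp => _ [I [n [x [nN EI ->]]]].
rewrite esum_mkcond -nneseries_esumT; last first.
  by move=> i; case: ifP => // _; rewrite lee_fin expR_ge0.
pose D i : set (borelType Q) := if i \in I then E `&` cylinder C (n i) (x i) else set0.
have mD i : measurable (D i).
  rewrite /D; case: ifP => // _; apply: measurableI => //.
  exact: measurable_cylinder.
have ED : E = \bigcup_i D i.
  apply/seteqP; split=> [y Ey|y [i _]].
    have [i Ii iy] := EI y Ey; exists i => //; rewrite /D mem_set //.
  by rewrite /D; case: ifP => // _ [].
rewrite [in leLHS]ED.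
apply: le_trans (generalized_Boole_inequality mu mD _) _.
  by rewrite -ED.
apply: lee_nneseries => // i _; rewrite /D.
case: ifP => [iI|_]; last by rewrite measure0.
have [->|/set0P[y [Ey xy]]] := eqVneq (E `&` cylinder C (n i) (x i)) set0.
  by rewrite measure0 lee_fin expR_ge0.
have Ni : (N <= n i)%N by apply: nN; rewrite inE in iI.
apply: (@le_trans _ _ (mu (cylinder C (n i) (x i)))).
  apply: le_measure; rewrite ?inE //.
  - by apply: measurableI => //; exact: measurable_cylinder.
  - exact: measurable_cylinder.
by rewrite -(cylinder_eq xy) -(cost_eq f xy); exact: smallE.
Qed.

Lemma lower_BS_pressure_le_dim mu (K : set Q) :
  measurable (K : set (borelType Q)) -> mu K = 1 ->
  lower_BS_pressure C f mu <= BS_dim C f K.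
Proof.
move=> mK muK; apply: le_ereal_inf_tmp => _ [lambda /= R0 <-].
pose E N : set (borelType Q) := K `&` \bigcap_(n in [set n | (N <= n)%N])
  [set x | mu (cylinder C n x) <= (expR (- lambda * cost C f n x))%:E].
have mE N : measurable (E N).
  apply: measurableI => //; apply: bigcap_measurableType => n _.
  apply: borel_open.
  apply: (@cylinder_invariant_open _ _ _ _ _ _ C_clopen n) => x y xy /=.
  by rewrite (cylinder_eq xy) (cost_eq f xy).
have E0 N : mu (E N) = 0.
  apply/eqP; rewrite eq_le measure_ge0 andbT.
  apply: (le_trans (@measure_le_BS_premeasure_at mu (E N) lambda N (mE N) _)).
    by move=> n x Nn [_ /(_ n Nn)].
  have <- := (BS_premeasure_eq0P C f K lambda).1 R0 N.
  apply: ereal_inf_le_tmp => s [I [n [x [nN KI ->]]]]; exists I, n, x; split=> //.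
  by move=> y [/KI].
(* For negative [lambda] the bound defining [E 0] is at least 1, so [E 0] would contain [K] and have
   mass 1. *)
have l0 : (0 <= lambda)%R.
  rewrite leNgt; apply/negP => l0; have : mu K <= mu (E 0%N).
    apply: le_measure; rewrite ?inE // => x Kx; split=> // n _ /=.
    apply: (@le_trans _ _ 1).
      by apply: probability_le1; exact: measurable_cylinder.
    by rewrite lee_fin -expR0 ler_expR mulr_ge0 ?cost_ge0 // oppr_ge0 ltW.
  by rewrite muK E0 leNgt lte_fin ltr01.
apply: (@le_trans _ _ (\int[mu]_(x in [set: borelType Q]) cst lambda%:E x)).
  apply: ae_ge0_le_integral => //.
  - by move=> x _; exact: limn_einf_local_pressure_ge0.
  - exact: measurable_limn_einf_local_pressure.
  (* A point of [K] whose local pressure exceeds [lambda] in the limit has only small cylinders from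
     some length on, hence lies in some [E N]. *)
  apply: (@negligibleS _ _ _ mu (~` K `|` \bigcup_N E N)).
    move=> x /= bad; have [Kx|] := pselect (K x); last by left.
    right; apply: contrapT => noE; apply: bad => _.
    rewrite leNgt; apply/negP => /near_lt_limn_einf[N _ Nl].
    (* The shift to [N.+1] keeps [n] positive, so that the cost is nonzero. *)
    apply: noE; exists N.+1 => //; split=> // n /= Nn.
    apply: lt_local_pressure; first exact: leq_trans Nn.
    by apply: Nl => /=; exact: ltnW.
  apply: negligibleU.
    exists (~` K); split=> //; first exact: measurableC.
    by rewrite [LHS](probability_setC mu mK) muK subee.
  apply: negligible_bigcup => N.
  by exists (E N); split; [exact: mE|exact: E0|].
by rewrite integral_cst // [X in _ * X](probability_setT mu) mule1.
Qed.

(** * Measures whose pressure approaches the dimension *)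

Lemma le_local_pressure mu n x (lambda : R) : (0 < n)%N ->
  mu (cylinder C n x) <= (expR (- lambda * cost C f n x))%:E ->
  lambda%:E <= local_pressure mu n x.
Proof.
move=> n0 le_mu; have c0 := cost_gt0 C f_gt0 x n0.
rewrite /local_pressure inver gt_eqF // lee_pdivlMr // leeNr -EFinM -EFinN.
rewrite -mulNr -[leRHS]expeRK lee_lne //.
- by rewrite in_itv /= leey andbT.
- by rewrite in_itv /= leey andbT lee_fin expR_ge0.
Qed.

Lemma dim_le_lower_BS_pressure (K : set Q) (lambda : R) : closed K ->
  lambda%:E < BS_dim C f K ->
  exists2 mu : probability (borelType Q) R, mu K = 1 &
    lambda%:E <= lower_BS_pressure C f mu.
Proof.
move=> clK lt_dim.
(* The gap between [lambda] and [l1] will absorb the constant factor [1 / M K] of the Frostman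
   bound. *)
have [l1 [lt_l1 l1_dim]] : exists l1 : R, (lambda < l1)%R /\ l1%:E < BS_dim C f K.
  apply: contrapT => no; move: lt_dim; rewrite ltNge => /negP; apply.
  apply: lee_fin_below => r r_dim; rewrite lee_fin leNgt; apply/negP => lr.
  by apply: no; exists r.
have [N RN] : exists N, 0 < BS_premeasure_at C f K l1 N.
  apply: contrapT => no; move: l1_dim; rewrite ltNge => /negP; apply.
  apply: BS_dim_le; apply/BS_premeasure_eq0P => N.
  apply/eqP; rewrite eq_le BS_premeasure_at_ge0 andbT leNgt; apply/negP => RN.
  by apply: no; exists N.
have MK := cover_content_gt0 RN; set M := cover_content C f l1 N in MK.
have cylE n x : cylinder C n x =
    [set y | cylinder_code C n y = cylinder_code C n x].
  by apply/seteqP; split=> y /=; move/cylinder_codeP.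
have [||||mu [muK mu_le]] := @ordered_cylinder_measure R Q K
    (cylinder_code C) M (@points_compact _ _ _ _ Q) uniform_regular
    (@points_second_countable _ _ _ _ Q) clK _ _ _ _
    (@le_cover_content _ _ _ _ _ C f l1 N) (@cover_contentU _ _ _ _ _ C f l1 N) MK.
- move=> n k; apply: (@cylinder_invariant_open _ _ _ _ _ _ C_clopen n).
  by move=> x y /cylinder_codeP xy /= <-.
- by move=> n; eexists => x; exact: cylinder_code_bounded.
- move=> n x y xy; rewrite -2!(cylinder_code_div C n _).
  exact: leq_div2r.
- exact: cover_content0.
exists mu => //.
(* Comparing integrals needs a nonnegative constant; for [lambda <= 0] nonnegativity of the pressure
   is enough. *)
have [l0|l0] := leP lambda 0%R.
  apply: (@le_trans _ _ 0); first by rewrite lee_fin.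
  by apply: integral_ge0 => x _; exact: limn_einf_local_pressure_ge0.
apply: (@le_trans _ _ (\int[mu]_(x in [set: borelType Q]) cst lambda%:E x)).
  by rewrite integral_cst // [X in _ * X](probability_setT mu) mule1.
apply: ge0_le_integral => //.
- by move=> x _; rewrite lee_fin ltW.
- exact: measurable_limn_einf_local_pressure.
move=> x _; apply: limn_einf_ge.
have [c c0 cost_c] := cost_linear_growth C f_gt0.
have d0 : (0 < (l1 - lambda) * c)%R by rewrite mulr_gt0 // subr_gt0.
(* From [n >= b] on, [(l1 - lambda) * cost] is at least [- ln (M K)], which turns the decay rate
   [l1] with its constant into the rate [lambda] without one. *)
pose b := (- ln (M K) / ((l1 - lambda) * c))%R.
exists (maxn N (Num.bound `|b|)).+1 => // n /= bn.
have [Nn bndn] : (N <= n)%N /\ (Num.bound `|b| <= n)%N.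
  by split; apply: leq_trans (ltnW bn); rewrite ?leq_maxl ?leq_maxr.
apply: le_local_pressure; first exact: leq_ltn_trans bn.
rewrite cylE; apply: (le_trans (mu_le n _)); rewrite -cylE lee_fin ler_pdivrMr //.
apply: (le_trans (cover_content_cylinder C f l1 x Nn)).
rewrite -[X in (_ <= _ * X)%R]lnK ?posrE // -expRD ler_expR.
have : (b <= n%:R)%R.
  apply: (le_trans (ler_norm b)); apply: (le_trans (ltW (archi_boundP _))) => //.
  by rewrite ler_nat.
rewrite ler_pdivrMr // => b_le.
have : ((l1 - lambda) * (n%:R * c) <= (l1 - lambda) * cost C f n x)%R.
  by rewrite ler_pM2l ?subr_gt0 // cost_c.
rewrite mulrCA; lra.
Qed.

End Pressure.

Theorem theorem1p4 (R : realType) (X U : metricType R)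
    (Sigma : control_system X U) (Q : controlled_invariant_set Sigma)
    (C : invariant_partition Q) (C_clopen : clopen_partition C)
    (K : set Q) (K_nonempty : K !=set0) (K_compact : compact K)
    (f : U -> R) (f_continuous : continuous f) (f_gt0 : forall u, 0 < f u) :
  BS_dim C f K =
  ereal_sup [set lower_BS_pressure C f mu |
    mu in [set mu : probability (borelType Q) R | mu K = 1%E]].
Proof.
have clK : closed K by apply: compact_closed => //; exact: points_hausdorff.
have mK : measurable (K : set (borelType Q)).
  rewrite -[K]setCK; apply: measurableC; apply: borel_open.
  exact: closed_openC.
apply/eqP; rewrite eq_le; apply/andP; split.
  (* Testing against real [r] below the dimension also covers an infinite dimension. *)
  apply: lee_fin_below => r /(dim_le_lower_BS_pressure C_clopen f_gt0 clK).
  move=> [mu muK r_mu]; apply: (le_trans r_mu).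
  by apply: ereal_sup_ubound; exists mu.
apply: ge_ereal_sup => _ [mu /= muK <-].
exact: lower_BS_pressure_le_dim.
Qed.
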